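(* Let $\mathcal{G}$ be a simple graph with finite vertex set $\{x_1,\ldots,x_n\}$ and let $I(\mathcal{G})\subseteq R=K[x_1,\ldots,x_n]$ be its edge ideal. If $\mathcal{G}$ does not have paths of length $\ge 3$, then $I(\mathcal{G})$ is a Lyubeznik totally ideal.
   Context: $K$ is a field. A simple graph has no loops or multiple edges; the length of a path is its number of edges. The edge ideal $I(\mathcal{G})$ is generated by all monomials $x_ix_j$ with $\{x_i,x_j\}$ an edge of $\mathcal{G}$. For a monomial ideal $I$, $G(I)$ is its minimal set of monomial generators. Given a total order on $G(I)=\{m_1\prec\cdots\prec m_\mu\}$, a symbol is $u(i_1;\ldots;i_t)$ with $1\le i_1<\cdots<i_t\le\mu$; it is $L$-admissible (of dimension $t$) if for all $h<t$ and all $q<i_h$, $m_q$ does not divide $\mathrm{lcm}(m_{i_h},\ldots,m_{i_t})$. The corresponding Lyubeznik resolution of $R/I$ is the free resolution with $L^0=R$, $L^t$ the free $R$-module on the $L$-admissible symbols of dimension $t$, and $$\partial_t(u(i_1;\ldots;i_t))=\sum_{j=1}^t(-1)^{j+1}\frac{\mathrm{lcm}(m_{i_1},\ldots,m_{i_t})}{\mathrm{lcm}(m_{i_1},\ldots,\widehat{m_{i_j}},\ldots,m_{i_t})}\,u(i_1;\ldots;\widehat{i_j};\ldots;i_t).$$ $I$ is a Lyubeznik totally ideal if for every total order on $G(I)$ the corresponding Lyubeznik resolution of $R/I$ is a minimal free resolution of $R/I$. *)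

(* Defs.v *)
From HB Require Import structures.
From mathcomp Require Import all_boot all_order all_algebra.
From mathcomp Require Import finmap mpoly.

Set Implicit Arguments.
Unset Strict Implicit.
Unset Printing Implicit Defensive.

Import GRing.Theory.
Local Open Scope ring_scope.

Definition ideal_gen (R : comNzRingType) (S : R -> Prop) (f : R) : Prop :=
  exists (k : nat) (c g : 'I_k -> R),
    (forall i, S (g i)) /\ f = \sum_(i < k) c i * g i.

(* The free module with basis B. *)
Definition freemod (R : comNzRingType) (B : finType) := {ffun B -> R^o}.
HB.instance Definition _ (R : comNzRingType) (B : finType) :=
  GRing.Lmodule.on (freemod R B).

Section FreeResolution.

Variables (R : comNzRingType) (I : R -> Prop) (B : nat -> finType).
Variable d : forall t, {linear freemod R (B t.+1) -> freemod R (B t)}.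
Variable eps : {scalar freemod R (B 0)}.

(* Exactness of ... -> F_1 -> F_0 -> R/I -> 0, where F_0 -> R/I is eps followed
   by reduction modulo I: a value is zero in R/I when it lies in I. *)
Definition free_resolution : Prop :=
  [/\ (forall r : R, exists f, I (eps f - r)),
      (forall f, I (eps f) <-> exists g, f = d 0 g) &
      (forall t f, d t f = 0 <-> exists g, f = d t.+1 g)].

(* Minimality with respect to an ideal m: the image of F_(t+1) lies in m F_t. *)
Definition minimal_free_resolution (m : R -> Prop) : Prop :=
  free_resolution /\ forall t f (b : B t), m (d t f b).

End FreeResolution.

Section MonomialIdeals.

Variables (K : fieldType) (n : nat).
Implicit Types (I : {mpoly K[n]} -> Prop) (G : {fset 'X_{1..n}}).

Definition monomial_gen (S : 'X_{1..n} -> Prop) : {mpoly K[n]} -> Prop :=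
  ideal_gen (fun p => exists2 a, S a & p = 'X_[a]).

Definition monomial_ideal I : Prop :=
  exists S : 'X_{1..n} -> Prop, forall p, I p <-> monomial_gen S p.

Definition generates G I : Prop :=
  forall p, I p <-> monomial_gen (fun a => a \in G) p.

Definition minimal_generators G I : Prop :=
  generates G I /\
  forall G', (G' `<=` G)%fset -> generates G' I -> G' = G.

(* The ideal (x_1, ..., x_n). *)
Definition irrelevant_ideal : {mpoly K[n]} -> Prop :=
  ideal_gen (fun p => exists i : 'I_n, p = 'X_i).

End MonomialIdeals.

Section LyubeznikResolution.

Variables (K : fieldType) (n mu : nat) (m : mu.-tuple 'X_{1..n}).

Definition lcm_symbol (u : seq 'I_mu) : 'X_{1..n} :=
  \big[@mlcm n/0%MM]_(i <- u) tnth m i.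

(* All indices are 0-based, so h < t becomes h.+1 < t and
   lcm(m_(i_h), ..., m_(i_t)) is the lcm over [drop h u]. *)
Definition L_admissible (t : nat) (u : t.-tuple 'I_mu) : bool :=
  sorted (fun i j : 'I_mu => (i < j)%N) u &&
  [forall h : 'I_t, (h.+1 < t)%N ==>
     [forall q : 'I_mu, (q < tnth u h)%N ==>
        ~~ (tnth m q <= lcm_symbol (drop h u))%MM]].

Definition L_symbol (t : nat) : finType := {u : t.-tuple 'I_mu | L_admissible u}.

Definition delete (j : nat) (u : seq 'I_mu) : seq 'I_mu :=
  take j u ++ drop j.+1 u.

(* The coefficient of v in the differential of u. Deleting an index preserves
   admissibility, so no term of the differential is lost. The 0-based j gives
   the sign (-1) ^+ j, and the difference of exponents is the quotient of lcms. *)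
Definition boundary_coef (t : nat) (v : L_symbol t) (u : L_symbol t.+1) :
    {mpoly K[n]} :=
  \sum_(j < t.+1 | tval (val v) == delete j (val u))
     (-1) ^+ j * 'X_[lcm_symbol (val u) - lcm_symbol (delete j (val u))].

Definition boundary (t : nat) (f : freemod {mpoly K[n]} (L_symbol t.+1)) :
    freemod {mpoly K[n]} (L_symbol t) :=
  [ffun v => \sum_u f u * boundary_coef v u].

Lemma boundary_is_linear t : linear (@boundary t).
Proof.
move=> a f g; apply/ffunP => v; rewrite !ffunE /GRing.scale /= mulr_sumr.
by rewrite -big_split; apply: eq_bigr => u _; rewrite !ffunE mulrDl -mulrA.
Qed.

HB.instance Definition _ t :=
  GRing.isLinear.Build {mpoly K[n]} (freemod {mpoly K[n]} (L_symbol t.+1))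
    (freemod {mpoly K[n]} (L_symbol t)) *:%R (@boundary t)
    (@boundary_is_linear t).

Lemma empty_admissible : L_admissible [tuple].
Proof. by apply/andP; split=> //; apply/forallP => -[]. Qed.

Definition empty_symbol : L_symbol 0 := Sub [tuple] empty_admissible.

(* The identification of L^0 with R; the empty symbol is the only one of
   dimension 0. *)
Definition augmentation (f : freemod {mpoly K[n]} (L_symbol 0)) : {mpoly K[n]} :=
  f empty_symbol.

Lemma augmentation_is_linear : scalar augmentation.
Proof. by move=> a f g; rewrite /augmentation !ffunE. Qed.

HB.instance Definition _ :=
  GRing.isLinear.Build {mpoly K[n]} (freemod {mpoly K[n]} (L_symbol 0))
    {mpoly K[n]} *%R augmentation augmentation_is_linear.

Definition lyubeznik_minimal (I : {mpoly K[n]} -> Prop) : Prop :=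
  minimal_free_resolution I (fun t => @boundary t) augmentation
    (@irrelevant_ideal K n).

End LyubeznikResolution.

Definition total_order_on (T : choiceType) (G : {fset T}) (le : rel T) : Prop :=
  [/\ {in G &, antisymmetric le}, {in G & &, transitive le} & {in G &, total le}].

Definition lyubeznik_totally (K : fieldType) (n : nat)
    (I : {mpoly K[n]} -> Prop) : Prop :=
  monomial_ideal I /\
  forall (G : {fset 'X_{1..n}}) (le : rel 'X_{1..n}),
    minimal_generators G I -> total_order_on G le ->
    lyubeznik_minimal (in_tuple (sort le G)) I.

Definition edge_ideal (K : fieldType) (n : nat) (e : rel 'I_n) :
    {mpoly K[n]} -> Prop :=
  ideal_gen (fun p => exists i j : 'I_n, e i j /\ p = 'X_i * 'X_j).

(* [i :: p] is a path when its vertices are pairwise distinct and consecutive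
   ones are adjacent; [size p] is then its number of edges. *)
Definition graph_path (n : nat) (e : rel 'I_n) (i : 'I_n) (p : seq 'I_n) : bool :=
  path e i p && uniq (i :: p).

(* Main.v *)
Require Import Defs.
From mathcomp Require Import all_boot all_order all_algebra.
From mathcomp Require Import finmap mpoly.

(** Two independent facts are combined.

    Exactness holds for every family of monomials [m], in every order.  The
    differential preserves the multidegree in which the basis element [u] has
    degree [lcm u], so fix a multidegree [a] and let [q] be the least index
    with [m_q] dividing [x^a].  The admissible symbols whose lcm divides [x^a]
    form a simplicial complex, and prefixing [q] keeps a symbol inside it
    ([admissible_cone]): nothing before [q] divides [x^a], so the new
    admissibility condition is vacuous.  The complex is thus a cone with apex
    [q], and prefixing the apex of the relevant multidegree to each term
    contracts the resolution ([contraction_homotopy]) wherever an apex exists,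
    that is, in positive dimension.  In dimension 0 exactness says that the
    [m_i] generate the ideal.

    Minimality means that deleting an index from an admissible symbol always
    makes the lcm strictly smaller, and this is where the graph enters
    ([edge_lcm_strict]).  If the edge [ab] divides the lcm of the other edges
    of [u], then [u] contains edges [ac] and [bd] with [c] distinct from [b]
    and [d] distinct from [a].  When [c] and [d] differ, [c, a, b, d] is a path
    of length 3.  Otherwise [u] contains the triangle [ab], [ac], [bc], each
    edge of which divides the lcm of the two others; the edge of least index
    then violates admissibility at the edge of second least index
    ([admissible_no_triangle]).

    Minimal generators of the edge ideal are edge monomials
    ([minimal_generators_sub]), which links the two parts. *)

Set Implicit Arguments.
Unset Strict Implicit.
Unset Printing Implicit Defensive.

(** * Alternating sums over deletions *)

Section AlternatingSum.
Import GRing.Theory.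
Local Open Scope ring_scope.
Variables (mu : nat) (V : zmodType).
Implicit Types (F G : seq 'I_mu -> V) (u : seq 'I_mu).

(** The simplicial differential of the function [F], see [alternatingE].
    Peeling off the first entry turns the identity [alternatingK] into a short
    induction, without any reindexing of double sums. *)
Fixpoint alternating F u : V :=
  if u is i :: u' then F u' - alternating (fun v => F (i :: v)) u' else 0.

Lemma alternatingE F u :
  alternating F u = \sum_(j < size u) (F (delete j u) *~ (-1) ^+ j).
Proof.
elim: u F => [|i u IHu] F /=; first by rewrite big_ord0.
rewrite big_ord_recl /delete /= drop0 mulr1z; congr (_ + _).
by rewrite IHu -sumrN; apply: eq_bigr => j _; rewrite exprS mulN1r mulrNz.
Qed.

Lemma eq_alternating F G u :
  (forall j, (j < size u)%N -> F (delete j u) = G (delete j u)) ->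
  alternating F u = alternating G u.
Proof.
by move=> eqFG; rewrite !alternatingE; apply: eq_bigr => j _; rewrite eqFG.
Qed.

Lemma alternatingB F G u :
  alternating (fun v => F v - G v) u = alternating F u - alternating G u.
Proof.
elim: u F G => [|i u IHu] F G /=; first by rewrite subrr.
by rewrite IHu [X in _ + X = _]opprD addrACA -opprD.
Qed.

Lemma alternatingK F u : alternating (alternating F) u = 0.
Proof.
elim: u F => [//|i u IHu] F /=.
by rewrite alternatingB IHu subr0 subrr.
Qed.

End AlternatingSum.

Lemma morph_alternating mu (V W : zmodType) (phi : V -> W)
    (F : seq 'I_mu -> V) (u : seq 'I_mu) :
  {morph phi : x y / (x - y)%R} ->
  phi (alternating F u) = alternating (fun v => phi (F v)) u.
Proof.
move=> phiB; elim: u F => [|i u IHu] F /=; last by rewrite phiB IHu.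
by rewrite -(GRing.subrr (0 : V)%R) phiB GRing.subrr.
Qed.

(** * Additive maps prescribed on monomials *)

Section MonomialwiseExtension.
Import GRing.Theory.
Local Open Scope ring_scope.
Variables (K : nzRingType) (n : nat) (V : zmodType).
Variable h : 'X_{1..n} -> K -> V.
Hypothesis hD : forall c, {morph h c : x y / x + y}.

(** The contracting homotopy treats each monomial of a polynomial differently,
    so it is not linear over the polynomial ring; it is built from this
    extension, which is only additive. *)
Definition monomialwise (p : {mpoly K[n]}) : V := \sum_(c <- msupp p) h c p@_c.

Let h0 c : h c 0 = 0.
Proof. by apply: (addrI (h c 0)); rewrite -hD !addr0. Qed.

(** Summing over any finite superset of the support gives a common index set
    for [p], [q] and [p + q]. *)
Lemma monomialwise_widen (l : seq 'X_{1..n}) p :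
  uniq l -> {subset msupp p <= l} -> monomialwise p = \sum_(c <- l) h c p@_c.
Proof.
move=> ul sub; rewrite (bigID (mem (msupp p))) /= [X in _ + X]big1 ?addr0.
  rewrite -big_filter; apply: perm_big; apply: uniq_perm => [||c].
  - exact: msupp_uniq.
  - exact: filter_uniq.
  by rewrite mem_filter; case: (boolP (c \in msupp p)) => // /sub ->.
by move=> c cNp; rewrite memN_msupp_eq0 ?h0.
Qed.

Lemma monomialwiseD : {morph monomialwise : p q / p + q}.
Proof.
move=> p q.
pose l := undup (msupp p ++ msupp q ++ msupp (p + q)).
have sub (r : {mpoly K[n]}) :
    {subset msupp r <= msupp p ++ msupp q ++ msupp (p + q)} ->
    monomialwise r = \sum_(c <- l) h c r@_c.
  move=> sr; apply: monomialwise_widen (undup_uniq _) _ => c /sr.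
  by rewrite mem_undup.
rewrite !sub; first last.
- by move=> c; rewrite !mem_cat => ->; rewrite !orbT.
- by move=> c; rewrite !mem_cat => ->.
- by move=> c; rewrite !mem_cat => ->; rewrite !orbT.
by rewrite -big_split; apply: eq_bigr => c _; rewrite mcoeffD hD.
Qed.

Lemma monomialwiseZX k a : monomialwise (k *: 'X_[a]) = h a k.
Proof.
rewrite (@monomialwise_widen [:: a]) //; last first.
  by move=> c /msuppZ_le; rewrite msuppX.
by rewrite big_seq1 mcoeffZ mcoeffX eqxx mulr1.
Qed.

End MonomialwiseExtension.

(** * Admissible sequences of indices *)

Section Admissible.
Variables (n mu : nat) (m : mu.-tuple 'X_{1..n}).
Implicit Types (u v : seq 'I_mu) (a : 'X_{1..n}).
Local Notation lcm := (lcm_symbol m).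

Lemma lcm_nil : lcm [::] = 0%MM.
Proof. by rewrite /lcm_symbol big_nil. Qed.

Lemma lcm_cons i u : lcm (i :: u) = mlcm (tnth m i) (lcm u).
Proof. by rewrite /lcm_symbol big_cons. Qed.

Lemma lcm_le u a : (lcm u <= a)%MM = all (fun i => (tnth m i <= a)%MM) u.
Proof.
elim: u => [|i u IHu]; last by rewrite lcm_cons lem_mlcm IHu.
by rewrite lcm_nil; apply/mnm_lepP => k; rewrite mnmE.
Qed.

Lemma dvd_lcm u i : i \in u -> (tnth m i <= lcm u)%MM.
Proof. by move: i; apply/allP; rewrite -lcm_le lepm_refl. Qed.

Lemma mem_delete j u : {subset delete j u <= u}.
Proof. by move=> i; rewrite mem_cat => /orP[/mem_take|/mem_drop]. Qed.

Lemma size_delete j u : (j < size u)%N -> size (delete j u) = (size u).-1.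
Proof.
move=> lt_ju; rewrite size_cat size_take size_drop lt_ju.
by case: (size u) lt_ju => // k; rewrite ltnS subSS => /subnKC.
Qed.

Lemma lcm_delete j u : (lcm (delete j u) <= lcm u)%MM.
Proof. by rewrite lcm_le; apply/allP => i /mem_delete/dvd_lcm. Qed.

Definition no_earlier_divisor i a : bool :=
  [forall q : 'I_mu, (q < i)%N ==> ~~ (tnth m q <= a)%MM].

(** Recursive form of [L_admissible] on untyped sequences, see [admissibleE]:
    deleting or prefixing an index does not force a change of tuple length.
    The last index carries no divisibility condition, whence the escape clause
    for an empty tail. *)
Fixpoint admissible u : bool :=
  if u is i :: u' then
    [&& all (fun j : 'I_mu => (i < j)%N) u',
        (u' == [::]) || no_earlier_divisor i (lcm u) & admissible u']
  else true.

Lemma admissibleE t (u : t.-tuple 'I_mu) : L_admissible m u = admissible u.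
Proof.
elim: t u => [|t IHt] u; first by rewrite tuple0; apply/forallP => -[].
case/tupleP: u => i u; rewrite /= -IHt /L_admissible /=.
rewrite path_sortedE; last by move=> x y z; apply: ltn_trans.
rewrite -!andbA; congr (_ && _); rewrite [RHS]andbCA; congr (_ && _).
apply/forallP/andP => [H | [H0 H] h].
  split; first last.
    apply/forallP => h; have := H (lift ord0 h).
    by rewrite lift0 /= ltnS tnthS.
  have := H ord0; rewrite /= tnth0.
  case: t u {IHt H} => [u _|t u /implyP/(_ isT) H0]; first by rewrite tuple0.
  by rewrite /no_earlier_divisor H0 orbT.
case: (unliftP ord0 h) => [h'|] ->.
  by rewrite tnthS lift0 ltnS; have /forallP := H; apply.
rewrite /= tnth0; apply/implyP; rewrite ltnS => t_gt0.
by move: H0; rewrite -size_eq0 size_tuple eqn0Ngt t_gt0.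
Qed.

Lemma admissible_delete j u : admissible u -> admissible (delete j u).
Proof.
rewrite /delete; elim: u j => [|i u IHu] [|j] //= /and3P[lt_iu div_iu adm_u].
  by rewrite drop0.
rewrite IHu // andbT; apply/andP; split.
  by apply/allP => k /mem_delete/(allP lt_iu).
have [->|u_nil] := eqVneq u [::]; first by [].
rewrite (negPf u_nil) /= in div_iu; apply/orP; right.
apply/forallP => q; apply/implyP => /(implyP (forallP div_iu q)).
apply: contra => /lepm_trans; apply.
by rewrite !lcm_cons lem_mlcm lem_mlcml (lepm_trans (lcm_delete j u)) ?lem_mlcmr.
Qed.

(** The condition at [y] excludes divisors of index less than [y]; the lcm
    tested there is at least that of [y] and [z]. *)
Lemma admissible_second_least u (x y z : 'I_mu) :
    admissible u -> y \in u -> z \in u -> (x < y)%N -> (y < z)%N ->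
  ~~ (tnth m x <= mlcm (tnth m y) (tnth m z))%MM.
Proof.
elim: u => [//|i u IHu] /and3P[/allP lt_iu div_iu adm_u].
rewrite !inE => /predU1P[->|yu] /predU1P[->|zu] lt_x; rewrite ?ltnn //.
- move=> _; case/predU1P: div_iu => [u0|/forallP/(_ x)/implyP/(_ lt_x)].
    by rewrite u0 in zu.
  apply: contra => /lepm_trans; apply.
  by rewrite lcm_cons lem_mlcm lem_mlcml (lepm_trans (dvd_lcm zu)) ?lem_mlcmr.
- by rewrite ltnNge (ltnW (lt_iu _ yu)).
- exact: IHu.
Qed.

Definition first_divisor a q : bool :=
  (tnth m q <= a)%MM && no_earlier_divisor q a.

Lemma first_divisor_uniq a q q' :
  first_divisor a q -> first_divisor a q' -> q = q'.
Proof.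
move=> /andP[qa /forallP min_q] /andP[q'a /forallP min_q'].
apply/val_inj; case: (ltngtP q q') => // [lt|lt].
  by have := min_q' q; rewrite lt qa.
by have := min_q q'; rewrite lt q'a.
Qed.

Lemma first_divisor_exists a i :
  (tnth m i <= a)%MM -> exists q, first_divisor a q.
Proof.
move=> ia.
have [q qa min_q] := @arg_minnP _ i (fun q => tnth m q <= a)%MM val ia.
exists q; rewrite /first_divisor qa; apply/forallP => q'.
by apply/implyP; rewrite ltnNge; apply: contra => /min_q.
Qed.

(** The symbols of multidegree at most [a] form a cone with apex [q]: a divisor
    of [lcm (q :: u)] is a divisor of [a], hence has index at least [q]. *)
Lemma admissible_cone a q u :
    first_divisor a q -> admissible u -> (lcm u <= a)%MM ->
  (exists v, u = q :: v) \/ admissible (q :: u).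
Proof.
case: u => [|i u]; first by right.
move=> /andP[qa /forallP min_q] adm_u le_ua.
have /andP[ia _] : all (fun j => tnth m j <= a)%MM (i :: u) by rewrite -lcm_le.
case: (ltngtP q i) => [lt_qi|lt_iq|/val_inj ->]; last by left; exists u.
  right; have := adm_u => /and3P[/allP lt_iu _ _].
  apply/and3P; split=> //.
    by apply/allP => j; rewrite inE => /predU1P[->//|/lt_iu]; apply: ltn_trans.
  apply/forallP => q'; apply/implyP => /(implyP (min_q q')).
  by apply: contra => /lepm_trans; apply; rewrite lcm_cons lem_mlcm qa.
by have := min_q i; rewrite lt_iq ia.
Qed.

End Admissible.

(** * The contracting homotopy *)

Section Resolution.
Import GRing.Theory.
Local Open Scope ring_scope.
Variables (K : fieldType) (n mu : nat) (m : mu.-tuple 'X_{1..n}).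
Implicit Types (u v : seq 'I_mu) (a c : 'X_{1..n}).
Local Notation lcm := (lcm_symbol m).
Local Notation P := {mpoly K[n]}.
Local Notation L t := (freemod P (L_symbol m t)).

(** The multiple [x^(a - lcm u) u] of the basis element [u] that has multidegree
    [a].  It is 0 when [u] is not an admissible symbol of dimension [t] or when
    its lcm does not divide [x^a], so that [contraction_graded_basis] also covers
    the terms that vanish. *)
Definition graded_basis t a u : L t :=
  [ffun v =>
     if (tval (val v) == u) && (lcm u <= a)%MM then 'X_[a - lcm u] else 0].

Lemma symbolP t u : size u = t -> admissible m u ->
  exists s : L_symbol m t, tval (val s) = u.
Proof.
move=> su adm_u; have su' : size u == t by apply/eqP.
have adm : L_admissible m (Tuple su') by rewrite admissibleE.
by exists (Sub (Tuple su') adm).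
Qed.

Lemma symbol_admissible t (s : L_symbol m t) : admissible m (tval (val s)).
Proof. by rewrite -admissibleE (valP s). Qed.

Lemma symbol_inj t (s s' : L_symbol m t) :
  tval (val s) = tval (val s') -> s = s'.
Proof. by move=> /val_inj/val_inj. Qed.

Lemma graded_basis_eq0 t a u :
  [|| size u != t, ~~ admissible m u | ~~ (lcm u <= a)%MM] ->
  graded_basis t a u = 0.
Proof.
move=> H; apply/ffunP => s; rewrite !ffunE; case: ifP => // /andP[/eqP Eu le_ua].
by move: H; rewrite le_ua -Eu size_tuple eqxx symbol_admissible.
Qed.

(** Within a fixed multidegree all monomial coefficients cancel: the
    differential is the simplicial one. *)
Lemma boundary_graded_basis t a u :
    size u = t.+1 -> admissible m u -> (lcm u <= a)%MM ->
  boundary (graded_basis t.+1 a u) = alternating (graded_basis t a) u.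
Proof.
move=> su adm_u le_ua; have [s Es] := symbolP su adm_u.
apply/ffunP => v.
rewrite (morph_alternating (phi := fun f : L t => f v)); last first.
  by move=> f g; rewrite !ffunE.
rewrite ffunE (bigD1 s) //= big1 ?addr0; last first.
  move=> s' s'Ns; rewrite ffunE; case: eqP => [Es'|_]; last by rewrite mul0r.
  by case/eqP: s'Ns; apply: symbol_inj; rewrite Es'.
rewrite ffunE Es eqxx le_ua /= /boundary_coef Es alternatingE su mulr_sumr.
rewrite [LHS]big_mkcond; apply: eq_bigr => j _.
rewrite ffunE; case: eqP => [_|_]; last by rewrite mul0rz.
rewrite (lepm_trans (lcm_delete m j u) le_ua) -mulrzr rmorphXn rmorphN rmorph1.
by rewrite mulrCA -mpolyXD addmBA ?lcm_delete // submK // [RHS]mulrC.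
Qed.

Definition cone t a u : L t.+1 :=
  if [pick q | first_divisor m a q] is Some q then graded_basis t.+1 a (q :: u)
  else 0.

Lemma coneE t a q u :
  first_divisor m a q -> cone t a u = graded_basis t.+1 a (q :: u).
Proof.
move=> aq; rewrite /cone; case: pickP => [q' aq'|/(_ q)]; last by rewrite aq.
by rewrite (first_divisor_uniq aq aq').
Qed.

(** A term [k x^c u] has multidegree [c + lcm u]; it is sent to the term of the
    same multidegree on [u] prefixed with the apex of that multidegree. *)
Definition contraction t (f : L t) : L t.+1 :=
  \sum_u monomialwise
    (fun c k => k%:MP *: cone t (c + lcm (tval (val u))) (tval (val u))) (f u).

Lemma cone_additive t u c :
  {morph (fun k => k%:MP *: cone t (c + lcm u) u) : x y / x + y}.
Proof. by move=> x y; rewrite mpolyCD scalerDl. Qed.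

Lemma contractionD t : {morph @contraction t : f g / f + g}.
Proof.
move=> f g; rewrite -big_split; apply: eq_bigr => u _.
rewrite ffunE monomialwiseD // => c; exact: cone_additive.
Qed.

Lemma contractionB t : {morph @contraction t : f g / f - g}.
Proof.
have c0 : contraction (0 : L t) = 0.
  by apply: (addrI (contraction (0 : L t))); rewrite -contractionD !addr0.
move=> f g; rewrite contractionD; congr (_ + _).
by apply: (addrI (contraction g)); rewrite -contractionD !subrr.
Qed.

Lemma contraction0 t : contraction (0 : L t) = 0.
Proof. by rewrite -(subrr (0 : L t)) contractionB subrr. Qed.

Lemma contraction_graded_basis t k a q u : first_divisor m a q ->
  contraction (k%:MP *: graded_basis t a u) =
  k%:MP *: graded_basis t.+1 a (q :: u).
Proof.
move=> aq; have [/and3P[/eqP su adm_u le_ua]|Nu] :=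
  boolP [&& size u == t, admissible m u & (lcm u <= a)%MM]; last first.
  rewrite !negb_and in Nu; rewrite !graded_basis_eq0 // ?scaler0 ?contraction0 //.
  rewrite /= eqSS lcm_cons lem_mlcm !negb_and.
  by case/or3P: Nu => ->; rewrite ?orbT.
have [s Es] := symbolP su adm_u.
rewrite /contraction (bigD1 s) //= big1 ?addr0.
  rewrite !ffunE Es eqxx le_ua /= /GRing.scale /= mul_mpolyC.
  rewrite monomialwiseZX ?submK ?(coneE _ _ aq) // => c; exact: cone_additive.
move=> s' s'Ns; rewrite !ffunE; case: eqP => [Es'|_].
  by case/eqP: s'Ns; apply: symbol_inj; rewrite Es'.
by rewrite scaler0 /monomialwise msupp0 big_nil.
Qed.

(** Additive statements need only be checked on terms of a single
    multidegree. *)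
Lemma freemod_ind t (Q : L t -> Prop) :
    Q 0 -> (forall f g, Q f -> Q g -> Q (f + g)) ->
    (forall k a u, size u = t -> admissible m u -> (lcm u <= a)%MM ->
       Q (k%:MP *: graded_basis t a u)) ->
  forall f, Q f.
Proof.
move=> Q0 QD Qb f.
have -> : f = \sum_s \sum_(c <- msupp (f s))
   ((f s)@_c)%:MP *: graded_basis t (c + lcm (tval (val s))) (tval (val s)).
  apply/ffunP => s; rewrite sum_ffunE (bigD1 s) //= [X in _ + X]big1 => [|s' s'Ns].
    rewrite addr0 sum_ffunE {1}[f s]mpolyE; apply: eq_bigr => c _.
    by rewrite !ffunE eqxx lem_addl addmK /GRing.scale /= mul_mpolyC.
  rewrite sum_ffunE big1 // => c _; rewrite !ffunE.
  case: eqP => [/symbol_inj E|_]; last exact: scaler0.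
  by rewrite E eqxx in s'Ns.
elim/big_ind: _ => // s _; elim/big_ind: _ => // c _.
by apply: Qb; rewrite ?size_tuple ?symbol_admissible ?lem_addl.
Qed.

Lemma boundaryZ t p (f : L t.+1) : boundary (p *: f) = p *: boundary f.
Proof. exact: linearZ. Qed.

Lemma boundaryD t : {morph @boundary K n mu m t : f g / f + g}.
Proof. exact: raddfD. Qed.

Lemma boundaryK t (f : L t.+2) : boundary (boundary f) = 0.
Proof.
elim/freemod_ind: f => [|f g Hf Hg|k a u su adm_u le_ua].
- by rewrite !raddf0.
- by rewrite !boundaryD Hf Hg addr0.
rewrite !boundaryZ boundary_graded_basis //.
rewrite (morph_alternating (phi := @boundary K n mu m t)); last exact: raddfB.
rewrite (_ : alternating _ u = 0) ?scaler0 //.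
rewrite -[RHS](alternatingK (graded_basis t a) u).
apply: eq_alternating => j lt_ju; apply: boundary_graded_basis.
- by rewrite size_delete // su.
- exact: admissible_delete.
- exact: lepm_trans (lcm_delete m j u) le_ua.
Qed.

(** Consider a term on [u] of multidegree [a] with apex [q].  Prefixing [q]
    commutes with the deletions in [u], so the two summands cancel except for
    deleting the new [q], which gives [u] back.
    If [u] already starts with [q], prefixing [q] gives 0 instead, and [u]
    comes from deleting that first [q] and restoring it.  Positive dimension is
    what guarantees that [q] exists. *)
Lemma contraction_homotopy t (f : L t.+1) :
  boundary (contraction f) + contraction (boundary f) = f.
Proof.
elim/freemod_ind: f => [|f g Hf Hg|k a u su adm_u le_ua].
- by rewrite raddf0 !contraction0 raddf0 addr0.
- rewrite boundaryD (contractionD f g) boundaryD.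
  rewrite (contractionD (boundary f)).
  rewrite [LHS]addrACA.
  by congr (_ + _).
case: u su adm_u le_ua => [//|i u] su adm_u le_ua.
have [q aq] : exists q, first_divisor m a q.
  apply: (@first_divisor_exists _ _ _ _ i).
  by have := le_ua; rewrite lcm_le => /andP[].
rewrite (contraction_graded_basis _ _ _ aq) !boundaryZ.
rewrite (boundary_graded_basis su) //.
have -> : contraction (k%:MP *: alternating (graded_basis t a) (i :: u)) =
    k%:MP *: alternating (fun v => graded_basis t.+1 a (q :: v)) (i :: u).
  rewrite (morph_alternating (phi := fun f => contraction (k%:MP *: f))).
    rewrite (morph_alternating (phi := fun f => k%:MP *: f)).
      by apply: eq_alternating => j _; exact: contraction_graded_basis.
    exact: scalerBr.
  by move=> f g; rewrite scalerBr contractionB.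
rewrite -[LHS]scalerDr; congr (_ *: _).
(* Either [u] starts with [q], or [q :: u] is again admissible. *)
have [[v [-> _]]|adm_qu] := admissible_cone aq adm_u le_ua.
  rewrite graded_basis_eq0 ?raddf0 ?add0r /=; last first.
    by rewrite ltnn orbT.
  rewrite [X in _ - X](_ : _ = 0) ?subr0 // alternatingE big1 // => j _.
  by rewrite graded_basis_eq0 ?mul0rz //= ltnn orbT.
rewrite boundary_graded_basis //; first by rewrite /= addrNK.
- by rewrite -su.
- by rewrite lcm_cons lem_mlcm le_ua; case/andP: aq => ->.
Qed.

Lemma boundary_exact t (f : L t.+1) :
  boundary f = 0 <-> exists g : L t.+2, f = boundary g.
Proof.
split=> [df0|[g ->]]; last exact: boundaryK.
exists (contraction f).
by rewrite -{1}(contraction_homotopy f) df0 contraction0 addr0.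
Qed.

End Resolution.

(** * Generated ideals and monomial ideals *)

Section GeneratedIdeal.
Import GRing.Theory.
Local Open Scope ring_scope.
Variables (R : comNzRingType) (S : R -> Prop).

Lemma ideal_gen_ind (Q : R -> Prop) :
    Q 0 -> (forall f g, Q f -> Q g -> Q (f + g)) ->
    (forall c g, S g -> Q (c * g)) ->
  forall f, ideal_gen S f -> Q f.
Proof.
move=> Q0 QD QS f [k [c [g [Sg ->]]]].
by elim/big_ind: _ => // i _; apply: QS.
Qed.

Lemma ideal_gen0 : ideal_gen S 0.
Proof.
by exists 0%N, (fun=> 0), (fun=> 0); split=> [[]//|]; rewrite big_ord0.
Qed.

Lemma ideal_genS c g : S g -> ideal_gen S (c * g).
Proof. by move=> Sg; exists 1%N, (fun=> c), (fun=> g); rewrite big_ord1. Qed.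

Lemma ideal_genD f g : ideal_gen S f -> ideal_gen S g -> ideal_gen S (f + g).
Proof.
move=> [k [c [a [Sa ->]]]] [l [d [b [Sb ->]]]].
pose glue (x : 'I_k -> R) (y : 'I_l -> R) i :=
  match split i with inl j => x j | inr j => y j end.
exists (k + l)%N, (glue c d), (glue a b); split.
  by move=> i; rewrite /glue; case: split.
rewrite big_split_ord; congr (_ + _); apply: eq_bigr => i _; rewrite /glue.
  by rewrite (unsplitK (inl i)).
by rewrite (unsplitK (inr i)).
Qed.

Lemma ideal_genM c f : ideal_gen S f -> ideal_gen S (c * f).
Proof.
elim/ideal_gen_ind => {f} [|f g Hf Hg|d g Sg].
- by rewrite mulr0; exact: ideal_gen0.
- by rewrite mulrDr; apply: ideal_genD.
by rewrite mulrA; apply: ideal_genS.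
Qed.

Lemma ideal_gen_sum (J : finType) (F : J -> R) :
  (forall j, ideal_gen S (F j)) -> ideal_gen S (\sum_j F j).
Proof.
by move=> SF; elim/big_ind: _ => //; [exact: ideal_gen0|exact: ideal_genD].
Qed.

End GeneratedIdeal.

Lemma ideal_gen_sub (R : comNzRingType) (S S' : R -> Prop) :
  (forall g, S g -> ideal_gen S' g) ->
  forall f, ideal_gen S f -> ideal_gen S' f.
Proof.
move=> SS' f; elim/ideal_gen_ind => [|g h|c g /SS'].
- exact: ideal_gen0.
- exact: ideal_genD.
- exact: ideal_genM.
Qed.

Section MonomialIdeal.
Import GRing.Theory.
Local Open Scope ring_scope.
Variables (K : fieldType) (n : nat).
Implicit Types (S : 'X_{1..n} -> Prop) (a b : 'X_{1..n}) (G : {fset 'X_{1..n}}).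

Lemma mcoeffMX_eq0 (p : {mpoly K[n]}) a b :
  ~~ (b <= a)%MM -> (p * 'X_[b])@_a = 0.
Proof.
move=> Nba; apply: memN_msupp_eq0; rewrite (perm_mem (msuppMX _ _)).
by apply: contra Nba => /mapP[c _ ->]; apply: lem_addr.
Qed.

Lemma mem_monomial_gen S a b : S b -> (b <= a)%MM -> @monomial_gen K n S 'X_[a].
Proof.
by move=> Sb le_ba; rewrite -(submK le_ba) mpolyXD; apply: ideal_genS; exists b.
Qed.

(** The coefficient of [x^a] in a combination of generators can only come from
    generators dividing [x^a]. *)
Lemma monomial_genP S a :
  @monomial_gen K n S 'X_[a] -> exists2 b, S b & (b <= a)%MM.
Proof.
move=> [k [c [g [Sg /(congr1 (mcoeff a))]]]].
rewrite mcoeffX eqxx raddf_sum /= => E.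
have [/existsP[i ne0]|/existsPn all0] := boolP [exists i, (c i * g i)@_a != 0].
  have [b Sb Eb] := Sg i; exists b => //.
  by apply: contraNT ne0 => /mcoeffMX_eq0 H; rewrite Eb H.
move: E; rewrite big1 => [/eqP|i _]; first by rewrite oner_eq0.
by apply/eqP; rewrite -[_ == _]negbK all0.
Qed.

(** Let [a] be in [G].  Some [b] in [S] divides [a] and some [a'] in [G] divides
    [b].  If [a'] and [a] differ, then [a] is redundant in [G]; so [a' = a], and
    [b] equals both. *)
Lemma minimal_generators_sub S (I : {mpoly K[n]} -> Prop) G a :
    minimal_generators G I -> (forall p, I p <-> monomial_gen S p) ->
  a \in G -> S a.
Proof.
move=> [genG minG] genS aG.
have /genS/monomial_genP[b Sb le_ba] : I 'X_[a].
  by apply/genG; apply: mem_monomial_gen aG (lepm_refl a).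
have /genG/monomial_genP[a' a'G le_a'b] : I 'X_[b].
  by apply/genS; apply: mem_monomial_gen Sb (lepm_refl b).
have [Ea'|a'Na] := eqVneq a' a.
  suff -> : a = b by [].
  apply/mnmP => k; apply/eqP; rewrite eqn_leq (mnm_lepP le_ba k) andbT.
  by rewrite -{1}Ea' (mnm_lepP le_a'b k).
have sub : (G `\ a `<=` G)%fset by apply: fsubD1set.
suff /(minG _ sub) E : generates (G `\ a)%fset I.
  by have := aG; rewrite -E !inE eqxx.
move=> p; split=> [/genG|Ip].
  apply: ideal_gen_sub => _ [c cG ->]; have [Eca|cNa] := eqVneq c a.
    apply: (@mem_monomial_gen _ c a'); last by rewrite Eca (lepm_trans le_a'b).
    by rewrite !inE a'Na.
  by apply: mem_monomial_gen (lepm_refl c); rewrite !inE cNa.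
apply/genG; move: Ip; apply: ideal_gen_sub => _ [c cG ->].
by apply: mem_monomial_gen (lepm_refl c); move: cG; rewrite !inE => /andP[].
Qed.

Lemma irrelevant_idealX a : a != 0%MM -> @irrelevant_ideal K n 'X_[a].
Proof.
move=> a_neq0; have [k ak] : exists k, a k != 0%N.
  apply/existsP; apply: contraNT a_neq0 => /existsPn a0.
  by apply/eqP/mnmP => k; rewrite mnmE; have := a0 k; rewrite negbK => /eqP.
have le_ka : (U_(k) <= a)%MM by rewrite lep1mP.
by rewrite -(submK le_ka) mpolyXD; apply: ideal_genS; exists k.
Qed.

End MonomialIdeal.

(** * Minimality criterion for the resolution *)

Section MinimalResolution.
Import GRing.Theory.
Local Open Scope ring_scope.
Variables (K : fieldType) (n mu : nat) (m : mu.-tuple 'X_{1..n}).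
Variable I : {mpoly K[n]} -> Prop.
Hypothesis genI : forall p, I p <-> monomial_gen (fun a => a \in m) p.
Local Notation lcm := (lcm_symbol m).
Local Notation L t := (freemod {mpoly K[n]} (L_symbol m t)).

Lemma augmentation_boundary (a : 'X_{1..n}) i : (tnth m i <= a)%MM ->
  augmentation (boundary (graded_basis K m 1 a [:: i])) = 'X_[a].
Proof.
move=> le_ia; rewrite boundary_graded_basis ?lcm_le /= ?le_ia //.
by rewrite subr0 /augmentation ffunE lcm_le lcm_nil subm0.
Qed.

Lemma augmentation_exact (f : L 0) :
  I (augmentation f) <-> exists g : L 1, f = boundary g.
Proof.
split=> [/genI H|[g ->{f}]].
  suff [g Eg] : exists g : L 1, augmentation (boundary g) = augmentation f.
    exists g; apply/ffunP => s; suff -> : s = empty_symbol m by [].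
    by apply/symbol_inj/eqP; rewrite /= -size_eq0 size_tuple.
  move: H; elim/ideal_gen_ind: (augmentation f) /
   => [|p q [g <-] [h <-]|p _ [a am ->]].
  - by exists 0; rewrite !raddf0.
  - by exists (g + h); rewrite !raddfD.
  have /tnthP[i Ei] := am; exists (p *: graded_basis K m 1 a [:: i]).
  by rewrite boundaryZ [LHS]linearZ /= augmentation_boundary // Ei lepm_refl.
apply/genI; elim/freemod_ind: g => [|g h|k a [|i [|j u]] // _ _ le_ua].
- by rewrite !raddf0; apply: ideal_gen0.
- by rewrite boundaryD raddfD; apply: ideal_genD.
have le_ia : (tnth m i <= a)%MM by move: le_ua; rewrite lcm_le => /andP[].
rewrite boundaryZ [augmentation _]linearZ /= augmentation_boundary //.
apply: ideal_genM; apply: (@mem_monomial_gen K n (fun b => b \in m)) le_ia.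
exact: mem_tnth.
Qed.

(** The entries of the differential are, up to sign, the quotients of
    [lcm u] by [lcm (delete j u)]; strictness makes them nonconstant. *)
Lemma lyubeznik_minimal_criterion :
    (forall u j, admissible m u -> (j < size u)%N ->
       ~~ (lcm u <= lcm (delete j u))%MM) ->
  lyubeznik_minimal m I.
Proof.
move=> strict; split; first split.
- move=> r; exists [ffun=> r]; rewrite /= /augmentation ffunE subrr.
  by apply/genI/ideal_gen0.
- exact: augmentation_exact.
- exact: boundary_exact.
move=> t f v; rewrite /= ffunE; apply: ideal_gen_sum => u; apply: ideal_genM.
rewrite /boundary_coef big_mkcond; apply: ideal_gen_sum => j.
case: ifP => _; last exact: ideal_gen0.
apply/ideal_genM/irrelevant_idealX.
apply: contra (strict _ j (symbol_admissible u) _).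
  move=> /eqP /mnmP E; apply/mnm_lepP => k.
  by have := E k; rewrite mnmBE mnmE => /eqP; rewrite subn_eq0.
by rewrite size_tuple.
Qed.

End MinimalResolution.

(** * Edge ideals of graphs without paths of length 3 *)

Section EdgeIdeal.
Local Open Scope nat_scope.

Lemma triangle_dvd n (a b c : 'I_n) : a != b ->
  (U_(a) + U_(b) <= mlcm (U_(a) + U_(c)) (U_(b) + U_(c)))%MM.
Proof.
move=> aNb; apply/mnm_lepP => k.
rewrite mnmDE [mlcm _ _ k]mnmE !mnmDE !mnm1E leq_max.
have [<-|_] := eqVneq a k; last by rewrite leq_addr orbT.
by rewrite [b == a]eq_sym (negPf aNb) leq_add2l.
Qed.

Lemma lcm_symbol_coord n mu (m : mu.-tuple 'X_{1..n}) u (k : 'I_n) :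
  lcm_symbol m u k != 0 -> exists2 i, i \in u & tnth m i k != 0.
Proof.
elim: u => [|i u IHu]; first by rewrite lcm_nil mnmE.
rewrite lcm_cons mnmE; have [ik0|ik _] := eqVneq (tnth m i k) 0; last first.
  by exists i; rewrite ?mem_head.
by rewrite ik0 max0n => /IHu[j ju jk]; exists j; rewrite // inE ju orbT.
Qed.

(** Divisibility among the three is symmetric, so whichever index is least
    contradicts [admissible_second_least]. *)
Lemma admissible_no_triangle n mu (m : mu.-tuple 'X_{1..n}) u (x y z : 'I_mu) :
    admissible m u -> x \in u -> y \in u -> z \in u ->
    x != y -> x != z -> y != z ->
    (tnth m x <= mlcm (tnth m y) (tnth m z))%MM ->
    (tnth m y <= mlcm (tnth m x) (tnth m z))%MM ->
    (tnth m z <= mlcm (tnth m x) (tnth m y))%MM ->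
  False.
Proof.
move=> adm_u xu yu zu xNy xNz yNz dvd_x dvd_y dvd_z.
have least (i j k : 'I_mu) : j \in u -> k \in u -> i < j -> i < k -> j != k ->
    (tnth m i <= mlcm (tnth m j) (tnth m k))%MM -> False.
  move=> ju ku lt_ij lt_ik; rewrite -val_eqE neq_ltn => /orP[lt_jk|lt_kj].
    by apply/negP; apply: admissible_second_least adm_u _ _ _ _.
  by rewrite mlcmC; apply/negP; apply: admissible_second_least adm_u _ _ _ _.
have := xNy; have := xNz; have := yNz; rewrite -!val_eqE !neq_ltn.
case/orP=> lt_yz /orP[]lt_xz /orP[]lt_xy.
- exact: (least x y z).
- by apply: (least y x z).
- by have := ltn_trans lt_xy lt_yz; rewrite ltnNge (ltnW lt_xz).
- by apply: (least y x z).
- exact: (least x y z).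
- by have := ltn_trans lt_xz lt_yz; rewrite ltnNge (ltnW lt_xy).
- by apply: (least z x y).
- by apply: (least z x y).
Qed.

Variables (n : nat) (e : rel 'I_n).
Hypothesis e_sym : ssrbool.symmetric e.
Hypothesis e_irr : irreflexive e.

Definition edge_monomial (a : 'X_{1..n}) : Prop :=
  exists i j : 'I_n, e i j /\ a = (U_(i) + U_(j))%MM.

Lemma edge_ideal_monomial (K : fieldType) p :
  @edge_ideal K n e p <-> monomial_gen edge_monomial p.
Proof.
split; apply: ideal_gen_sub.
  move=> _ [i [j [eij ->]]]; rewrite -mpolyXD -[X in ideal_gen _ X]GRing.mul1r.
  by apply: ideal_genS; exists (U_(i) + U_(j))%MM => //; exists i, j.
move=> _ [_ [i [j [eij ->]]] ->]; rewrite mpolyXD.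
rewrite -[X in ideal_gen _ X]GRing.mul1r.
by apply: ideal_genS; exists i, j.
Qed.

Lemma edge_monomial_at a i : edge_monomial a -> a i != 0 ->
  exists2 j, e i j & a = (U_(i) + U_(j))%MM.
Proof.
move=> [j [k [ejk ->]]]; rewrite mnmDE !mnm1E.
have [Eji|_] := eqVneq j i; first by move=> _; exists k; rewrite -Eji.
have [Eki|//] := eqVneq k i; move=> _; exists j; first by rewrite e_sym -Eki.
by rewrite addmC Eki.
Qed.

Hypothesis no_long_path :
  forall (i : 'I_n) (p : seq 'I_n), graph_path e i p -> ~~ (3 <= size p).

Lemma edge_lcm_strict mu (m : mu.-tuple 'X_{1..n}) u j :
    uniq m -> (forall i, edge_monomial (tnth m i)) ->
    admissible m u -> j < size u ->
  ~~ (lcm_symbol m u <= lcm_symbol m (delete j u))%MM.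
Proof.
move=> uniq_m edge_m adm_u lt_ju; apply/negP => le_lcm.
have inj_m : injective (tnth m) by apply/tuple_uniqP.
have [x xu xNdel] : exists2 x, x \in u & x \notin delete j u.
  have uniq_u : uniq u.
    elim: (u) adm_u => //= i v IHv /and3P[/allP lt_iv _ /IHv ->]; rewrite andbT.
    by apply/negP => /lt_iv; rewrite ltnn.
  have x0 : 'I_mu by case: (u) lt_ju.
  exists (nth x0 u j); first exact: mem_nth.
  move: uniq_u; rewrite -{1}(cat_take_drop j u) (drop_nth x0) //.
  by rewrite (uniq_catC _ (_ :: _)) /= mem_cat orbC -mem_cat => /andP[].
have le_x := lepm_trans (dvd_lcm m xu) le_lcm.
have [a [b [eab Ex]]] := edge_m x.
have aNb : a != b by apply: contraTneq eab => ->; rewrite e_irr.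
have neighbour k : tnth m x k != 0 -> exists y c,
    [/\ y \in u, y != x, e k c & tnth m y = (U_(k) + U_(c))%MM].
  move=> xk; have [|y ydel yk] := @lcm_symbol_coord _ _ m (delete j u) k.
    by rewrite -lt0n (leq_trans _ (mnm_lepP le_x k)) // lt0n.
  have [c ekc Ey] := edge_monomial_at (edge_m y) yk.
  exists y, c; split=> //; first exact: mem_delete ydel.
  by apply: contraNneq xNdel => <-.
(* [y] covers the vertex [a] of the edge [x], and [z] its vertex [b]. *)
have [|y [c [yu yNx eac Ey]]] := neighbour a.
  by rewrite Ex mnmDE mnm1E eqxx.
have [|z [d [zu zNx ebd Ez]]] := neighbour b.
  by rewrite Ex mnmDE !mnm1E eqxx addn1.
have cNb : c != b.
  by apply: contraNneq yNx => cb; apply/eqP/inj_m; rewrite Ey Ex cb.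
have dNa : d != a.
  by apply: contraNneq zNx => da; apply/eqP/inj_m; rewrite Ez Ex da addmC.
have cNa : c != a by apply: contraTneq eac => ->; rewrite e_irr.
have bNd : b != d by apply: contraTneq ebd => ->; rewrite e_irr.
(* Otherwise [c, a, b, d] would be a path of length 3. *)
have Edc : d = c.
  apply/eqP/negPn/negP => dNc; have := @no_long_path c [:: a; b; d].
  rewrite /graph_path /= e_sym eac eab ebd !inE !negb_or.
  rewrite cNa cNb [c == d]eq_sym dNc aNb [a == d]eq_sym dNa bNd.
  by move/(_ isT).
rewrite {}Edc in Ez ebd dNa bNd.
have yNz : y != z.
  apply: contra_neq aNb => yz; have := Ez; rewrite -yz Ey => /addIm/mnmP/(_ a).
  by rewrite !mnm1E eqxx; case: eqP.
apply: (admissible_no_triangle adm_u xu yu zu _ _ yNz).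
- by rewrite eq_sym.
- by rewrite eq_sym.
- by rewrite Ex Ey Ez; apply: triangle_dvd.
- by rewrite Ex Ey Ez [(U_(b) + U_(c))%MM]addmC; apply: triangle_dvd; rewrite eq_sym.
- rewrite Ex Ey Ez [(U_(a) + U_(b))%MM]addmC mlcmC ![(_ + U_(c))%MM]addmC.
  exact: triangle_dvd.
Qed.
End EdgeIdeal.

Theorem proposition5p12 (K : fieldType) (n : nat) (e : rel 'I_n)
    (e_sym : ssrbool.symmetric e) (e_irr : irreflexive e)
    (no_long_path :
       forall (i : 'I_n) (p : seq 'I_n), graph_path e i p -> ~~ (3 <= size p)%N) :
  lyubeznik_totally (@edge_ideal K n e).
Proof.
split; first by exists (edge_monomial e); apply: edge_ideal_monomial.
move=> G le minG _; apply: lyubeznik_minimal_criterion => [p|u j adm_u lt_ju].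
  have [genG _] := minG; split=> [/genG|Ip].
    apply: ideal_gen_sub => _ [a aG ->]; apply: mem_monomial_gen (lepm_refl a).
    by rewrite /= mem_sort.
  apply/genG; move: Ip; apply: ideal_gen_sub => _ [a aG ->].
  by apply: mem_monomial_gen (lepm_refl a); move: aG; rewrite /= mem_sort.
apply: edge_lcm_strict => //.
- by rewrite sort_uniq fset_uniq.
- move=> i; apply: (minimal_generators_sub minG).
    exact: edge_ideal_monomial.
  by have := mem_tnth i (in_tuple (sort le G)); rewrite mem_sort.
Qed.
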